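(* Let $f:\mathbb{R}\to\mathbb{R}$ be a positive $2\pi$-periodic $C^1$ function such that $$\int_0^{2\pi}f(\theta)\cos\theta\, d\theta=\int_0^{2\pi}f(\theta)\sin\theta\, d\theta=0.$$ Then for every $2\pi$-periodic $C^1$ function $\phi:\mathbb{R}\to\mathbb{R}$ satisfying $$\int_0^{2\pi}f(\theta)\phi(\theta)\,d\theta=0,$$ we have $$\int_0^{2\pi}\phi(\theta)^2\,d\theta\leq\int_0^{2\pi}(\phi'(\theta))^2\,d\theta .$$ Moreover, equality is attained only when $\phi(\theta)=a\cos\theta+b\sin\theta$ for some real constants $a,b$.
   Context: All functions are real-valued. *)

(* Defs.v *)
From Stdlib Require Import Reals.
From Coquelicot Require Import Coquelicot.
Open Scope R_scope.

Definition is_C1 (f : R -> R) : Prop :=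
  (forall x : R, ex_derive f x) /\ (forall x : R, continuous (Derive f) x).

Definition periodic (T : R) (f : R -> R) : Prop :=
  forall x : R, f (x + T) = f x.

(* Main.v *)
(** Since [f] is orthogonal to [cos] and [sin], it is [h'' + h] for a periodic [h],
the support function of a convex body; putting the origin on the boundary makes
[h > 0] on [(0, 2 PI)]. Integrating by parts, [h] is orthogonal to [phi] for the
quadratic form [E(u) = int u'^2 - u^2], and [E(h) = - int f h < 0]. With [t] such
that [phi + t h] has mean zero,
  [E(phi) = E(phi + t h) + t^2 int f h],
so everything follows from Wirtinger's inequality for functions of mean zero. For
the latter, subtract a multiple of [cos (x - c)] to make the function vanish at two
antipodal points, and bound each half period separately. *)

Require Import Defs.
From Stdlib Require Import Reals Lra Lia ZArith.
From Coquelicot Require Import Coquelicot.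
Open Scope R_scope.

(** * Continuity, differentiation and integration on the line *)

Lemma continuous_is_derive (F : R -> R) (x l : R) :
  is_derive F x l -> continuous F x.
Proof.
intros H; apply (ex_derive_continuous (V := R_NormedModule)); now exists l.
Qed.

Ltac solve_continuous :=
  first
  [ assumption
  | match goal with
    | H : forall x, continuous ?f x |- continuous ?f _ => apply H
    | H : forall x, continuous ?f x |- continuous (fun y => ?f y) _ => apply H
    | H : forall x, is_derive ?f x _ |- continuous ?f _ =>
        exact (continuous_is_derive _ _ _ (H _))
    | H : forall x, is_derive ?f x _ |- continuous (fun y => ?f y) _ =>
        exact (continuous_is_derive _ _ _ (H _))
    end
  | apply continuous_const
  | apply continuous_id
  | match goal with
    | |- continuous (fun x => @?f x + @?g x) _ => apply (continuous_plus f g)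
    | |- continuous (fun x => @?f x - @?g x) _ => apply (continuous_minus f g)
    | |- continuous (fun x => - @?f x) _ => apply (continuous_opp f)
    | |- continuous (fun x => @?f x * @?g x) _ => apply (continuous_mult f g)
    | |- continuous (fun x => @?f x ^ 2) _ =>
        apply (continuous_mult f (fun x => f x * 1)); [| apply (continuous_mult f (fun _ => 1))]
    | |- continuous (fun x => cos (@?f x)) _ =>
        apply (continuous_comp f cos); [| apply continuous_cos]
    | |- continuous (fun x => sin (@?f x)) _ =>
        apply (continuous_comp f sin); [| apply continuous_sin]
    end; solve_continuous ].

(** Coquelicot states some equalities in the carrier of an algebraic structure; this retypes them
    over [R] so that [ring] and [field] apply. *)
Ltac real_eq := match goal with |- @eq _ ?a ?b => change (@eq R a b) end.

Lemma is_derive_shift (F : R -> R) (T x l : R) :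
  is_derive F (x + T) l -> is_derive (fun y => F (y + T)) x l.
Proof.
intros dF; evar_last.
- apply (is_derive_comp F (fun y => y + T)); [exact dF|].
  apply (is_derive_plus (fun y => y) (fun _ => T)); [apply is_derive_id|apply is_derive_const].
- unfold scal, plus, one, zero; simpl; unfold mult; simpl; ring.
Qed.

Lemma ex_RInt_continuity (g : R -> R) (a b : R) :
  (forall x, continuous g x) -> ex_RInt g a b.
Proof. intros H; apply (ex_RInt_continuous (V := R_CompleteNormedModule)); auto. Qed.

Lemma is_derive_RInt_continuity (g : R -> R) (a x : R) :
  (forall x, continuous g x) -> is_derive (fun y => RInt g a y) x (g x).
Proof.
intros H; apply (is_derive_RInt (V := R_CompleteNormedModule) g _ a); [|apply H].
exists (mkposreal 1 Rlt_0_1); intros y _; apply RInt_correct.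
now apply ex_RInt_continuity.
Qed.

Lemma RInt_is_derive (G g : R -> R) (a b : R) :
  (forall x, is_derive G x (g x)) -> (forall x, continuous g x) ->
  RInt g a b = G b - G a.
Proof.
intros dG cg; apply is_RInt_unique.
apply (is_RInt_derive (V := R_CompleteNormedModule) G g); auto.
Qed.

Lemma RInt_split (g : R -> R) (a b c : R) :
  (forall x, continuous g x) -> RInt g a c = RInt g a b + RInt g b c.
Proof.
intros H; symmetry; apply (RInt_Chasles g); now apply ex_RInt_continuity.
Qed.

(** Translation by [T] carries the integral over [[0, c]] to the one over [[T, c + T]]; Chasles does
    the rest. *)
Lemma RInt_periodic (g : R -> R) (T c : R) :
  periodic T g -> (forall x, continuous g x) -> RInt g c (c + T) = RInt g 0 T.
Proof.
intros Hp cg.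
assert (HT : RInt g T (c + T) = RInt g 0 c).
{ transitivity (RInt g (1 * 0 + T) (1 * c + T)); [f_equal; ring|].
  rewrite <- (RInt_comp_lin g) by now apply ex_RInt_continuity.
  apply RInt_ext; intros x _; unfold scal; simpl; unfold mult; simpl.
  rewrite !Rmult_1_l; apply Hp. }
rewrite (RInt_split g c 0 (c + T)), (RInt_split g 0 T (c + T)), HT by assumption.
rewrite <- (opp_RInt_swap g) by now apply ex_RInt_continuity.
unfold opp; simpl; ring.
Qed.

(** Near [d] the numerator is [O((x - d)^2)], while [s x] is at least of order [x - d], so the
    quotient tends to 0. Its value at [d] is 0 as well, because the numerator vanishes there,
    whatever the value of [/ 0]. *)
Lemma continuous_sqr_div (F s : R -> R) (d l m : R) :
  F d = 0 -> s d = 0 -> m <> 0 -> is_derive F d l -> is_derive s d m ->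
  continuous (fun x => F x ^ 2 / s x) d.
Proof.
intros F0 s0 m0 [_ dF] [_ ds].
assert (m1 : 0 < Rabs m) by now apply Rabs_pos_lt.
specialize (dF d (fun P H => H) (mkposreal 1 Rlt_0_1)); simpl in dF.
assert (m2 : 0 < Rabs m / 2) by lra.
specialize (ds d (fun P H => H) (mkposreal _ m2)); simpl in ds.
set (M := Rabs l + 1).
assert (M0 : 0 < M) by (unfold M; generalize (Rabs_pos l); lra).
apply filterlim_locally; intros eps.
(* With [u = x - d], the quotient is at most [(M |u|)^2 / (|m| / 2 * |u|)], which is below [eps]
   exactly when [|u|] is below this radius. *)
assert (e0 : 0 < eps * Rabs m / (2 * M ^ 2)).
{ apply Rdiv_lt_0_compat; [apply Rmult_lt_0_compat; [apply cond_pos|assumption]|].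
  apply Rmult_lt_0_compat; [lra|now apply pow_lt]. }
assert (dx := locally_ball d (mkposreal _ e0)).
generalize (filter_and _ _ dF (filter_and _ _ ds dx)); apply filter_imp.
clear dF ds dx; intros x [H1 [H2 H3]].
revert H1 H2 H3; unfold ball; simpl; unfold AbsRing_ball, abs, minus, plus, opp, scal, norm; simpl.
unfold mult, abs; simpl; rewrite F0, s0; intros H1 H2 H3.
set (u := x + - d) in *.
assert (A1 : Rabs (F x) <= M * Rabs u).
{ replace (F x) with ((F x + - 0 + - (u * l)) + u * l) by ring.
  eapply Rle_trans; [apply Rabs_triang|]; rewrite Rabs_mult; unfold M; lra. }
assert (A2 : Rabs m / 2 * Rabs u <= Rabs (s x)).
{ assert (T := Rabs_triang (- (s x + - 0 + - (u * m))) (s x)).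
  replace (- (s x + - 0 + - (u * m)) + s x) with (u * m) in T by ring.
  rewrite Rabs_mult, Rabs_Ropp in T; lra. }
match goal with |- Rabs ?y < _ => replace y with (F x ^ 2 / s x) by (unfold Rdiv; ring) end.
destruct (Req_dec u 0) as [u0|u0].
- rewrite u0, Rabs_R0, Rmult_0_r in A1.
  assert (E : F x = 0).
  { destruct (Req_dec (F x) 0) as [|N]; [assumption|].
    apply Rabs_pos_lt in N; lra. }
  rewrite E; replace (0 ^ 2 / s x) with 0 by (unfold Rdiv; ring); rewrite Rabs_R0.
  apply cond_pos.
- assert (u1 := Rabs_pos_lt _ u0).
  assert (s1 : 0 < Rabs (s x)) by (eapply Rlt_le_trans; [|apply A2]; nra).
  unfold Rdiv; rewrite Rabs_mult, Rabs_inv, <- RPow_abs.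
  apply Rmult_lt_reg_r with (Rabs (s x)); [assumption|].
  rewrite Rmult_assoc, Rinv_l, Rmult_1_r by lra.
  assert (P : Rabs (F x) ^ 2 <= (M * Rabs u) ^ 2).
  { apply pow_incr; split; [apply Rabs_pos|assumption]. }
  assert (M2 : 0 < M ^ 2) by now apply pow_lt.
  assert (H4 : Rabs u * M ^ 2 < eps * (Rabs m / 2)).
  { apply Rmult_lt_reg_r with (/ M ^ 2); [now apply Rinv_0_lt_compat|].
    rewrite Rmult_assoc, Rinv_r, Rmult_1_r by lra.
    eapply Rlt_le_trans; [apply H3|]; right; field; lra. }
  assert (e1 := cond_pos eps).
  apply Rle_lt_trans with ((Rabs u * M ^ 2) * Rabs u); [lra|].
  apply Rlt_le_trans with (eps * (Rabs m / 2) * Rabs u); [nra|].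
  rewrite Rmult_assoc; apply Rmult_le_compat_l; lra.
Qed.

Lemma nondecreasing_on_interval (K k : R -> R) (a b : R) :
  (forall x, a < x < b -> is_derive K x (k x)) ->
  (forall x, a <= x <= b -> continuous K x) ->
  (forall x, a < x < b -> 0 <= k x) ->
  forall x y, a <= x -> x <= y -> y <= b -> K x <= K y.
Proof.
intros dK cK k0 x y ax xy yb.
(* [MVT_gen] may return an endpoint, where [k] has unknown sign. *)
destruct (MVT_gen K x y (fun z => Rmax (k z) 0)) as [c [_ Hc]].
- rewrite Rmin_left, Rmax_right by assumption; intros z Hz.
  rewrite Rmax_left by (apply k0; lra); apply dK; lra.
- rewrite Rmin_left, Rmax_right by assumption; intros z Hz.
  apply continuity_pt_filterlim, cK; lra.
- assert (H := Rmax_r (k c) 0); simpl in Hc; nra.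
Qed.

(** * Wirtinger's inequality on a half period *)

Definition energy (F F' : R -> R) (a b : R) : R :=
  RInt (fun x => F' x ^ 2 - F x ^ 2) a b.

(* [F'^2 - F^2 = (F' - F cot)^2 + (F^2 cot)'], and [F^2 cot] extends by 0 to both endpoints. *)
Lemma half_period_wirtinger (F F' : R -> R) (c : R) :
  (forall x, is_derive F x (F' x)) -> (forall x, continuous F' x) ->
  F c = 0 -> F (c + PI) = 0 ->
  0 <= energy F F' c (c + PI) /\
  (energy F F' c (c + PI) = 0 ->
   exists a, forall x, c <= x <= c + PI -> F x = a * sin (x - c)).
Proof.
intros dF cF' F0 F1.
assert (PI0 := PI_RGT_0).
set (s := fun x => sin (x - c)).
assert (ds : forall x, is_derive s x (cos (x - c))).
{ intros x; unfold s; auto_derive; [auto|apply Rmult_1_l]. }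
assert (s0 : s c = 0) by (unfold s; now rewrite Rminus_diag, sin_0).
assert (s1 : s (c + PI) = 0).
{ unfold s; replace (c + PI - c) with PI by ring; apply sin_PI. }
assert (spos : forall x, c < x < c + PI -> 0 < s x).
{ intros x Hx; apply sin_gt_0; lra. }
set (e := fun x => F' x ^ 2 - F x ^ 2).
assert (ce : forall x, continuous e x) by (intros x; unfold e; solve_continuous).
(* [K] is the primitive of [(F' - F cot)^2] that starts at 0. The boundary term vanishes at both
   ends, so [K] climbs from 0 at [c] to the energy at [c + PI]. *)
set (K := fun x => RInt e c x - F x ^ 2 / s x * cos (x - c)).
assert (dK : forall x, c < x < c + PI ->
  is_derive K x ((F' x - F x * cos (x - c) / s x) ^ 2)).
{ intros x Hx; specialize (spos x Hx).
  assert (dR := is_derive_RInt_continuity e c x ce).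
  assert (dQ : is_derive (fun x => F x ^ 2 / s x * cos (x - c)) x
    ((2 * F x * F' x * s x - F x ^ 2 * cos (x - c)) / s x ^ 2 * cos (x - c)
      - F x ^ 2 / s x * s x)).
  { specialize (dF x); specialize (ds x).
    auto_derive.
    - repeat split; try lra; [now exists (F' x)|now exists (cos (x - c))].
    - rewrite (is_derive_unique (fun x : R => F x) _ _ dF), (is_derive_unique (fun x : R => s x) _ _ ds).
      change (sin (x + - c)) with (s x); unfold Rminus; real_eq; field; lra. }
  assert (dM := is_derive_minus _ _ _ _ _ dR dQ).
  unfold minus, plus, opp in dM; simpl in dM.
  evar_last; [exact dM|].
  unfold e; field; lra. }
assert (cK : forall x, c <= x <= c + PI -> continuous K x).
{ intros x Hx; unfold K.
  assert (continuous (fun y => RInt e c y) x).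
  { eapply continuous_is_derive, is_derive_RInt_continuity, ce. }
  assert (continuous (fun y => F y ^ 2 / s y) x).
  { destruct (Req_dec x c) as [->|nc].
    - apply (continuous_sqr_div F s c (F' c) (cos (c - c))); auto.
      rewrite Rminus_diag, cos_0; lra.
    - destruct (Req_dec x (c + PI)) as [->|nd].
      + apply (continuous_sqr_div F s _ (F' (c + PI)) (cos (c + PI - c))); auto.
        replace (c + PI - c) with PI by ring; rewrite cos_PI; lra.
      + assert (0 < s x) by (apply spos; lra).
        apply (continuous_mult (fun y => F y ^ 2) (fun y => / s y)); [solve_continuous|].
        apply continuous_comp; [solve_continuous|].
        apply (filterlim_Rbar_inv (s x)); intros E; injection E; lra. }
  solve_continuous. }
assert (mono := nondecreasing_on_interval K _ c (c + PI) dK cK (fun x _ => pow2_ge_0 _)).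
assert (K0 : K c = 0).
{ unfold K; rewrite RInt_point, F0; unfold zero, Rdiv; simpl; ring. }
assert (K1 : K (c + PI) = energy F F' c (c + PI)).
{ unfold K; rewrite F1; fold e; unfold energy, Rdiv; fold e; ring. }
split; [rewrite <- K0, <- K1; apply mono; lra|].
(* Zero energy forces the monotone [K] to be constant, so the square [K'] vanishes inside:
   [F' = F cot], which says that [F / s] has derivative 0. *)
intros E.
assert (Kz : forall x, c <= x <= c + PI -> K x = 0).
{ intros x Hx; apply Rle_antisym.
  - rewrite <- E, <- K1; apply mono; lra.
  - rewrite <- K0; apply mono; lra. }
assert (F'E : forall x, c < x < c + PI -> F' x = F x * cos (x - c) / s x).
{ intros x Hx.
  assert (D0 : is_derive K x 0).
  { apply (is_derive_ext_loc (fun _ => 0)); [|apply (is_derive_const 0)].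
    apply (locally_interval _ x c (c + PI)); simpl; try lra.
    intros y H1 H2; symmetry; apply Kz; simpl in *; lra. }
  assert (Q := is_derive_unique _ _ _ (dK x Hx)).
  rewrite (is_derive_unique _ _ _ D0) in Q.
  nra. }
(* The constant value of [F / s] is read off at the midpoint, where [s] is 1. *)
exists (F (c + PI / 2)); intros x Hx.
destruct (Req_dec x c) as [->|nc]; [fold (s c); rewrite s0, F0; ring|].
destruct (Req_dec x (c + PI)) as [->|nd]; [fold (s (c + PI)); rewrite s1, F1; ring|].
assert (sx : 0 < s x) by (apply spos; lra).
assert (inner : forall z, Rmin x (c + PI / 2) <= z <= Rmax x (c + PI / 2) -> c < z < c + PI).
{ intros z; unfold Rmin, Rmax; destruct (Rle_dec x (c + PI / 2)); lra. }
assert (dq : forall z, c < z < c + PI -> is_derive (fun y => F y / s y) z 0).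
{ intros z Hz; specialize (spos z Hz); specialize (F'E z Hz).
  specialize (dF z); specialize (ds z).
  auto_derive.
  - repeat split; try lra; [now exists (F' z)|now exists (cos (z - c))].
  - rewrite (is_derive_unique (fun x : R => F x) _ _ dF), (is_derive_unique (fun x : R => s x) _ _ ds).
    rewrite F'E; real_eq; field; lra. }
destruct (MVT_gen (fun y => F y / s y) x (c + PI / 2) (fun _ => 0)) as [d [_ Hd]].
- intros z Hz; apply dq, inner; lra.
- intros z Hz; apply continuity_pt_filterlim.
  exact (continuous_is_derive _ _ _ (dq z (inner z Hz))).
- assert (s2 : s (c + PI / 2) = 1).
  { unfold s; replace (c + PI / 2 - c) with (PI / 2) by ring; apply sin_PI2. }
  simpl in Hd; rewrite s2 in Hd.
  replace (F (c + PI / 2)) with (F x / s x) by lra.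
  fold (s x); field; lra.
Qed.

(** * Periodic functions and their energy *)

Lemma periodic_cos : periodic (2 * PI) cos.
Proof. intros x; rewrite cos_plus, cos_2PI, sin_2PI; ring. Qed.

Lemma periodic_sin : periodic (2 * PI) sin.
Proof. intros x; rewrite sin_plus, cos_2PI, sin_2PI; ring. Qed.

Lemma periodic_INR (T : R) (G : R -> R) (n : nat) (x : R) :
  periodic T G -> G (x + INR n * T) = G x.
Proof.
intros Hp; induction n as [|n IH].
- f_equal; simpl; ring.
- rewrite S_INR, <- IH, <- (Hp (x + INR n * T)); f_equal; ring.
Qed.

Lemma periodic_representative (T c x : R) :
  0 < T ->
  exists y, c <= y <= c + T /\ forall G, periodic T G -> G x = G y.
Proof.
intros T0; set (k := Int_part ((x - c) / T)).
destruct (base_Int_part ((x - c) / T)) as [k1 k2]; fold k in k1, k2.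
assert (E : (x - c) / T * T = x - c) by (field; lra).
exists (x - IZR k * T); split; [nra|].
(* [periodic_INR] shifts only by a natural number of periods, so the shift starts from [y] or from
   [x] according to the sign of [k]. *)
intros G Hp; destruct (Z_le_gt_dec 0 k) as [Hk|Hk].
- rewrite <- (periodic_INR T G (Z.to_nat k) (x - IZR k * T) Hp).
  rewrite INR_IZR_INZ, Z2Nat.id by assumption; f_equal; ring.
- rewrite <- (periodic_INR T G (Z.to_nat (- k)) x Hp).
  rewrite INR_IZR_INZ, Z2Nat.id by lia; rewrite opp_IZR; f_equal; ring.
Qed.

Lemma periodic_is_derive (T : R) (F F' : R -> R) :
  periodic T F -> (forall x, is_derive F x (F' x)) -> periodic T F'.
Proof.
intros Hp dF x.
assert (D := is_derive_shift F T x _ (dF (x + T))).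
rewrite <- (is_derive_unique _ _ _ D), <- (is_derive_unique _ _ _ (dF x)).
apply Derive_ext; intros y; apply Hp.
Qed.

Lemma energy_split (F F' : R -> R) (a b c : R) :
  (forall x, continuous F x) -> (forall x, continuous F' x) ->
  energy F F' a c = energy F F' a b + energy F F' b c.
Proof. intros cF cF'; apply RInt_split; intros x; solve_continuous. Qed.

Lemma energy_periodic (F F' : R -> R) (T c : R) :
  periodic T F -> (forall x, is_derive F x (F' x)) -> (forall x, continuous F' x) ->
  energy F F' c (c + T) = energy F F' 0 T.
Proof.
intros Hp dF cF'; apply RInt_periodic; [|intros x; solve_continuous].
intros x; rewrite (Hp x), (periodic_is_derive _ _ _ Hp dF x); reflexivity.
Qed.

(** Here [g = h'' + h]. The integrand grows by [(2 F' + h') h' - (2 F + h) h], which is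
    [P' - (2 F + h) g] for [P = (2 F + h) h']; the equal boundary values make [P'] integrate to
    0. *)
Lemma energy_add (F F' h h' g : R -> R) (a b : R) :
  (forall x, is_derive F x (F' x)) -> (forall x, continuous F' x) ->
  (forall x, is_derive h x (h' x)) -> (forall x, is_derive h' x (g x - h x)) ->
  (forall x, continuous g x) ->
  F a = F b -> h a = h b -> h' a = h' b ->
  energy (fun x => F x + h x) (fun x => F' x + h' x) a b =
  energy F F' a b - RInt (fun x => (2 * F x + h x) * g x) a b.
Proof.
intros dF cF' dh dh' cg Fab hab h'ab.
set (P := fun x => (2 * F x + h x) * h' x).
set (P' := fun x => (2 * F' x + h' x) * h' x + (2 * F x + h x) * (g x - h x)).
assert (dP : forall x, is_derive P x (P' x)).
{ intros x; unfold P, P'; specialize (dF x); specialize (dh x); specialize (dh' x).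
  auto_derive.
  - repeat split; [now exists (F' x)|now exists (h' x)|now exists (g x - h x)].
  - rewrite (is_derive_unique (fun x : R => F x) _ _ dF),
      (is_derive_unique (fun x : R => h x) _ _ dh),
      (is_derive_unique (fun x : R => h' x) _ _ dh').
    real_eq; ring. }
assert (IP := RInt_is_derive P P' a b dP).
unfold P at 1 2 in IP; rewrite Fab, hab, h'ab, Rminus_diag in IP.
assert (cP' : forall x, continuous P' x) by (intros x; unfold P'; solve_continuous).
specialize (IP cP').
set (e := fun x => F' x ^ 2 - F x ^ 2); set (w := fun x => (2 * F x + h x) * g x).
assert (ce : forall x, continuous e x) by (intros x; unfold e; solve_continuous).
assert (cw : forall x, continuous w x) by (intros x; unfold w; solve_continuous).
unfold energy; fold e.
transitivity (RInt (fun x => plus (minus (e x) (w x)) (P' x)) a b).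
- apply RInt_ext; intros x _; unfold minus, plus, opp, e, w, P'; simpl; ring.
- rewrite (RInt_plus (fun x => minus (e x) (w x)) P'), (RInt_minus e w), IP.
  + unfold minus, plus, opp; simpl; ring.
  + now apply ex_RInt_continuity.
  + now apply ex_RInt_continuity.
  + apply ex_RInt_continuity; intros x; apply (continuous_minus e w); auto.
  + now apply ex_RInt_continuity.
Qed.

(** * Wirtinger's inequality for functions of mean zero *)

(** The sum [psi x + psi (x + PI)] has integral 0 over [[0, PI]], so the mean value theorem for its
    primitive [G] gives a zero. *)
Lemma exists_antipodal (psi : R -> R) :
  (forall x, continuous psi x) -> RInt psi 0 (2 * PI) = 0 ->
  exists c, psi (c + PI) = - psi c.
Proof.
intros cpsi I0; assert (PI0 := PI_RGT_0).
set (G := fun x => RInt psi 0 x + RInt psi PI (x + PI)).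
assert (dG : forall x, is_derive G x (psi x + psi (x + PI))).
{ intros x; apply (is_derive_plus (fun x => RInt psi 0 x) (fun x => RInt psi PI (x + PI)));
    [now apply is_derive_RInt_continuity|].
  apply is_derive_shift with (F := fun y => RInt psi PI y).
  now apply is_derive_RInt_continuity. }
destruct (MVT_gen G 0 PI (fun x => psi x + psi (x + PI))) as [c [_ Hc]].
- intros x _; apply dG.
- intros x _; apply continuity_pt_filterlim; exact (continuous_is_derive _ _ _ (dG x)).
- exists c; unfold G in Hc; rewrite RInt_point in Hc.
  replace (0 + PI) with PI in Hc by ring; rewrite RInt_point in Hc.
  replace (PI + PI) with (2 * PI) in Hc by ring.
  assert (S := RInt_split psi 0 PI (2 * PI) cpsi).
  unfold zero in Hc; simpl in Hc; nra.
Qed.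

Lemma RInt_half_sine (a c : R) :
  RInt (fun x => a * sin (x - c)) c (c + PI) = 2 * a.
Proof.
rewrite (RInt_is_derive (fun x => - a * cos (x - c))).
- replace (c + PI - c) with PI by ring; rewrite Rminus_diag, cos_PI, cos_0; real_eq; ring.
- intros x; auto_derive; [auto|unfold Rminus; real_eq; ring].
- intros x; solve_continuous.
Qed.

(** The correction [h] solves [h'' + h = 0], so adding it leaves the energy over a period unchanged.
    The corrected [F] vanishes at [c], [c + PI] and [c + 2 PI], which splits this energy into two
    nonnegative halves. *)
Lemma wirtinger (psi psi' : R -> R) :
  periodic (2 * PI) psi -> (forall x, is_derive psi x (psi' x)) ->
  (forall x, continuous psi' x) -> RInt psi 0 (2 * PI) = 0 ->
  0 <= energy psi psi' 0 (2 * PI) /\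
  (energy psi psi' 0 (2 * PI) = 0 ->
   exists a b, forall x, psi x = a * cos x + b * sin x).
Proof.
intros Hp dpsi cpsi' I0; assert (PI0 := PI_RGT_0).
assert (cpsi : forall x, continuous psi x) by (intros x; solve_continuous).
destruct (exists_antipodal psi cpsi I0) as [c Hc].
set (m := psi c) in *.
set (h := fun x => - m * cos (x - c)); set (h' := fun x => m * sin (x - c)).
assert (dh : forall x, is_derive h x (h' x)).
{ intros x; unfold h, h'; auto_derive; [auto|unfold Rminus; real_eq; ring]. }
assert (dh' : forall x, is_derive h' x (0 - h x)).
{ intros x; unfold h, h'; auto_derive; [auto|unfold Rminus; real_eq; ring]. }
assert (hp : periodic (2 * PI) h).
{ intros x; unfold h; replace (x + 2 * PI - c) with (x - c + 2 * PI) by ring.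
  now rewrite periodic_cos. }
assert (h'p := periodic_is_derive _ _ _ hp dh).
set (F := fun x => psi x + h x); set (F' := fun x => psi' x + h' x).
assert (EF : energy F F' c (c + 2 * PI) = energy psi psi' 0 (2 * PI)).
{ unfold F, F'; rewrite (energy_add psi psi' h h' (fun _ => 0)); auto.
  - rewrite (energy_periodic _ _ _ _ Hp dpsi cpsi').
    rewrite (RInt_ext _ (fun _ => 0)) by (intros; apply Rmult_0_r).
    rewrite RInt_const; unfold scal; simpl; unfold mult; simpl; ring.
  - intros x; apply continuous_const. }
assert (dF : forall x, is_derive F x (F' x)).
{ intros x; apply (is_derive_plus psi h); auto. }
assert (cF' : forall x, continuous F' x) by (intros x; unfold F'; solve_continuous).
assert (F0 : F c = 0).
{ unfold F, h; rewrite Rminus_diag, cos_0; unfold m; ring. }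
assert (F1 : F (c + PI) = 0).
{ unfold F, h; rewrite Hc; replace (c + PI - c) with PI by ring; rewrite cos_PI; ring. }
assert (F2 : F (c + PI + PI) = 0).
{ rewrite <- F0; unfold F; rewrite <- (Hp c), <- (hp c); f_equal; f_equal; ring. }
destruct (half_period_wirtinger F F' c dF cF' F0 F1) as [P1 Q1].
destruct (half_period_wirtinger F F' (c + PI) dF cF' F1 F2) as [P2 Q2].
rewrite (energy_split F F' c (c + PI)) in EF; [|intros x; solve_continuous|assumption].
replace (c + 2 * PI) with (c + PI + PI) in EF by ring.
split; [lra|]; intros E.
destruct Q1 as [a Ha]; [lra|]; destruct Q2 as [b Hb]; [lra|].
(* In the equality case [F] consists of two sine arcs of amplitudes [a] and [b]. Since [h = (- h')']
   integrates to 0 over a period, so does [F]; hence [2 a + 2 b = 0] and the arcs join into a single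
   [a * sin (x - c)]. *)
assert (IF : RInt F c (c + 2 * PI) = 0).
{ rewrite (RInt_periodic F).
  - unfold F; rewrite (RInt_plus psi h), I0.
    + rewrite (RInt_is_derive (fun x => - h' x) h).
      * assert (E0 := h'p 0); rewrite Rplus_0_l in E0; cbv beta; rewrite E0.
        unfold plus; simpl; ring.
      * intros x; evar_last; [apply (is_derive_opp h'), dh'|].
        unfold opp; simpl; ring.
      * intros x; solve_continuous.
    + now apply ex_RInt_continuity.
    + apply ex_RInt_continuity; intros x; solve_continuous.
  - intros x; unfold F; now rewrite Hp, hp.
  - intros x; solve_continuous. }
replace (c + 2 * PI) with (c + PI + PI) in IF by ring.
rewrite (RInt_split F c (c + PI)) in IF by (intros x; solve_continuous).
rewrite (RInt_ext F (fun x => a * sin (x - c)) c (c + PI)) in IF.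
2: { intros x Hx; rewrite Rmin_left, Rmax_right in Hx by lra; apply Ha; lra. }
rewrite (RInt_ext F (fun x => b * sin (x - (c + PI))) (c + PI)) in IF.
2: { intros x Hx; rewrite Rmin_left, Rmax_right in Hx by lra; apply Hb; lra. }
rewrite !RInt_half_sine in IF.
(* Coefficients of [a * sin (x - c) + m * cos (x - c)], which is [F - h]. The difference [D] is
   periodic, so it suffices that it vanish on [[c, c + 2 PI]]. *)
exists (m * cos c - a * sin c), (a * cos c + m * sin c); intros x.
set (D := fun x => psi x - ((m * cos c - a * sin c) * cos x + (a * cos c + m * sin c) * sin x)).
assert (Dp : periodic (2 * PI) D).
{ intros y; unfold D; now rewrite Hp, periodic_cos, periodic_sin. }
destruct (periodic_representative (2 * PI) c x) as [y [Hy Hxy]]; [lra|].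
cut (D x = 0); [unfold D; lra|].
rewrite (Hxy D Dp).
assert (FE : F y = a * sin (y - c)).
{ destruct (Rle_dec y (c + PI)) as [l|l].
  - apply Ha; lra.
  - rewrite Hb by lra.
    replace (y - (c + PI)) with (- (PI - (y - c))) by ring.
    rewrite sin_neg, sin_PI_x; replace b with (- a) by lra; ring. }
unfold F, h in FE; unfold D.
rewrite sin_minus, cos_minus in FE; lra.
Qed.

(** * Construction of the support function *)

Lemma periodic_primitive (g : R -> R) (T : R) :
  periodic T g -> (forall x, continuous g x) -> RInt g 0 T = 0 ->
  periodic T (fun x => RInt g 0 x).
Proof.
intros Hp cg I0 x.
rewrite (RInt_split g 0 x (x + T)), (RInt_periodic g T x), I0 by assumption.
apply Rplus_0_r.
Qed.

(* [h x] is the integral of [f t * sin (x - t)] over [t] in [[0, x]], equivalently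
   that of [f t * sin (t - x)] over [[x, 2 * PI]]: the first form shows that [h] is
   positive on the first half of the period, the second on the other half. *)
Lemma exists_support_function (f : R -> R) :
  (forall t, 0 < f t) -> periodic (2 * PI) f -> (forall t, continuous f t) ->
  RInt (fun t => f t * cos t) 0 (2 * PI) = 0 ->
  RInt (fun t => f t * sin t) 0 (2 * PI) = 0 ->
  exists h h' : R -> R,
    periodic (2 * PI) h /\
    (forall x, is_derive h x (h' x)) /\
    (forall x, is_derive h' x (f x - h x)) /\
    (forall x, 0 < x < 2 * PI -> 0 < h x).
Proof.
intros f0 fp cf Ic Is; assert (PI0 := PI_RGT_0).
set (u := fun t => f t * cos t); set (v := fun t => f t * sin t).
assert (cu : forall x, continuous u x).
{ intros x; unfold u; apply (continuous_mult f cos); [apply cf|apply continuous_cos]. }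
assert (cv : forall x, continuous v x).
{ intros x; unfold v; apply (continuous_mult f sin); [apply cf|apply continuous_sin]. }
set (C := fun x => RInt u 0 x); set (S := fun x => RInt v 0 x).
assert (dC : forall x, is_derive C x (u x)) by (intros; now apply is_derive_RInt_continuity).
assert (dS : forall x, is_derive S x (v x)) by (intros; now apply is_derive_RInt_continuity).
assert (Cp : periodic (2 * PI) C).
{ apply periodic_primitive; auto; intros x; unfold u; now rewrite fp, periodic_cos. }
assert (Sp : periodic (2 * PI) S).
{ apply periodic_primitive; auto; intros x; unfold v; now rewrite fp, periodic_sin. }
(* Variation of constants, from expanding [sin (x - t)]. In [h'] the terms [sin x * u x] and
   [cos x * v x] cancel; the vanishing moments of [f] make [C] and [S], hence [h], periodic. *)
exists (fun x => sin x * C x - cos x * S x), (fun x => cos x * C x + sin x * S x).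
split; [|split; [|split]].
- intros x; now rewrite Cp, Sp, periodic_cos, periodic_sin.
- intros x; specialize (dC x); specialize (dS x).
  auto_derive; [split; [now exists (u x)|split; [now exists (v x)|auto]]|].
  rewrite (is_derive_unique (fun x : R => C x) _ _ dC),
    (is_derive_unique (fun x : R => S x) _ _ dS).
  unfold u, v; real_eq; ring.
- intros x; specialize (dC x); specialize (dS x).
  auto_derive; [split; [now exists (u x)|split; [now exists (v x)|auto]]|].
  rewrite (is_derive_unique (fun x : R => C x) _ _ dC),
    (is_derive_unique (fun x : R => S x) _ _ dS).
  assert (E := sin2_cos2 x); unfold Rsqr in E.
  transitivity (f x * (sin x * sin x + cos x * cos x) - (sin x * C x - cos x * S x)).
  + unfold u, v; real_eq; ring.
  + rewrite E; real_eq; ring.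
- intros x Hx.
  assert (kernel : forall a b, RInt (fun t => f t * sin (x - t)) a b =
    sin x * RInt u a b - cos x * RInt v a b).
  { intros a b; apply is_RInt_unique.
    apply (is_RInt_ext (fun t => minus (scal (sin x) (u t)) (scal (cos x) (v t)))).
    - intros t _; unfold minus, plus, opp, scal, u, v; simpl; unfold mult; simpl.
      rewrite sin_minus; real_eq; ring.
    - apply (is_RInt_minus (V := R_NormedModule)); apply (is_RInt_scal (V := R_NormedModule));
        apply (RInt_correct (V := R_CompleteNormedModule)); now apply ex_RInt_continuity. }
  destruct (Rle_dec x PI) as [l|l].
  + unfold C, S; rewrite <- kernel; apply RInt_gt_0; [lra| |intros t _; solve_continuous].
    intros t Ht; apply Rmult_lt_0_compat; [apply f0|apply sin_gt_0; lra].
  + assert (EC := RInt_split u 0 x (2 * PI) cu); assert (ES := RInt_split v 0 x (2 * PI) cv).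
    fold u in Ic; fold v in Is; rewrite Ic in EC; rewrite Is in ES.
    fold (C x) in EC; fold (S x) in ES.
    assert (pos : 0 < RInt (fun t => f t * sin (t - x)) x (2 * PI)).
    { apply RInt_gt_0; [lra| |intros t _; solve_continuous].
      intros t Ht; apply Rmult_lt_0_compat; [apply f0|apply sin_gt_0; lra]. }
    rewrite (RInt_ext _ (fun t => opp (f t * sin (x - t)))) in pos.
    * rewrite (RInt_opp (fun t => f t * sin (x - t))), kernel in pos.
      -- unfold opp in pos; simpl in pos.
         replace (C x) with (- RInt u x (2 * PI)) by lra.
         replace (S x) with (- RInt v x (2 * PI)) by lra.
         lra.
      -- apply ex_RInt_continuity; intros t; solve_continuous.
    * intros t _; replace (t - x) with (- (x - t)) by ring.
      rewrite sin_neg; unfold opp; simpl; ring.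
Qed.

(** * The weighted inequality and its equality case *)

Theorem theorem1p1 :
  forall f : R -> R,
    (forall t : R, 0 < f t) ->
    periodic (2 * PI) f ->
    is_C1 f ->
    RInt (fun t => f t * cos t) 0 (2 * PI) = 0 ->
    RInt (fun t => f t * sin t) 0 (2 * PI) = 0 ->
    forall phi : R -> R,
      periodic (2 * PI) phi ->
      is_C1 phi ->
      RInt (fun t => f t * phi t) 0 (2 * PI) = 0 ->
      RInt (fun t => phi t ^ 2) 0 (2 * PI)
        <= RInt (fun t => Derive phi t ^ 2) 0 (2 * PI)
      /\ (RInt (fun t => phi t ^ 2) 0 (2 * PI)
            = RInt (fun t => Derive phi t ^ 2) 0 (2 * PI) ->
          exists a b : R, forall t : R, phi t = a * cos t + b * sin t).
Proof.
intros f f0 fp [df _] Ic Is phi phip [exphi cphi'] If.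
assert (PI0 := PI_RGT_0).
assert (cf : forall x, continuous f x).
{ intros x; apply (ex_derive_continuous (V := R_NormedModule)), df. }
assert (dphi : forall x, is_derive phi x (Derive phi x)) by (intros x; apply Derive_correct, exphi).
set (phi' := Derive phi) in *.
destruct (exists_support_function f f0 fp cf Ic Is) as [h [h' [hp [dh [dh' h0]]]]].
assert (h'p := periodic_is_derive _ _ _ hp dh).
assert (ch : forall x, continuous h x) by (intros x; solve_continuous).
assert (cphi : forall x, continuous phi x) by (intros x; solve_continuous).
assert (Ih : 0 < RInt h 0 (2 * PI)) by (apply RInt_gt_0; auto; lra).
set (w := fun x => h x * f x).
assert (cw : forall x, continuous w x) by (intros x; unfold w; solve_continuous).
assert (Iw : 0 < RInt w 0 (2 * PI)).
{ apply RInt_gt_0; auto; [lra|]; intros x Hx; apply Rmult_lt_0_compat; auto. }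
(* This [t] makes the mean of [phi + t h] zero; the denominator is nonzero by [Ih]. *)
set (t := - (RInt phi 0 (2 * PI) / RInt h 0 (2 * PI))).
set (psi := fun x => phi x + t * h x); set (psi' := fun x => phi' x + t * h' x).
assert (dth : forall x, is_derive (fun x => t * h x) x (t * h' x)).
{ intros x; apply (is_derive_scal h x t), dh. }
assert (dth' : forall x, is_derive (fun x => t * h' x) x (t * f x - t * h x)).
{ intros x; rewrite <- Rmult_minus_distr_l; apply (is_derive_scal h' x t), dh'. }
(* [energy_add] with [g = t f] subtracts the integral of [2 t f phi + t^2 h f], whose first term
   integrates to 0 by the orthogonality of [f] and [phi]. *)
assert (Epsi : energy psi psi' 0 (2 * PI) =
  energy phi phi' 0 (2 * PI) - t ^ 2 * RInt w 0 (2 * PI)).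
{ unfold psi, psi'.
  rewrite (energy_add phi phi' (fun x => t * h x) (fun x => t * h' x) (fun x => t * f x)); auto.
  - f_equal.
    transitivity (RInt (fun x => plus (scal (2 * t) (f x * phi x)) (scal (t ^ 2) (w x))) 0 (2 * PI)).
    + apply RInt_ext; intros x _; unfold plus, scal, w; simpl; unfold mult; simpl; ring.
    + apply is_RInt_unique.
      replace (t ^ 2 * RInt w 0 (2 * PI)) with
        (plus (scal (2 * t) (RInt (fun x => f x * phi x) 0 (2 * PI)))
          (scal (t ^ 2) (RInt w 0 (2 * PI))))
        by (rewrite If; unfold plus, scal; simpl; unfold mult; simpl; ring).
      apply (is_RInt_plus (V := R_NormedModule)); apply (is_RInt_scal (V := R_NormedModule));
        apply (RInt_correct (V := R_CompleteNormedModule)), ex_RInt_continuity; auto.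
      intros x; solve_continuous.
  - intros x; solve_continuous.
  - rewrite <- (phip 0); f_equal; ring.
  - rewrite <- (hp 0); do 2 f_equal; ring.
  - rewrite <- (h'p 0); do 2 f_equal; ring. }
destruct (wirtinger psi psi') as [P Q].
- intros x; unfold psi; now rewrite phip, hp.
- intros x; apply (is_derive_plus phi (fun x => t * h x)); auto.
- intros x; unfold psi'; solve_continuous.
- unfold psi; rewrite (RInt_plus phi (fun x => scal t (h x))), (RInt_scal h).
  + unfold plus, scal, t; simpl; unfold mult; simpl; field; lra.
  + now apply ex_RInt_continuity.
  + now apply ex_RInt_continuity.
  + apply ex_RInt_continuity; intros x; unfold scal; simpl; unfold mult; simpl; solve_continuous.
- assert (E : energy phi phi' 0 (2 * PI) =
    RInt (fun t => phi' t ^ 2) 0 (2 * PI) - RInt (fun t => phi t ^ 2) 0 (2 * PI)).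
  { unfold energy; apply (RInt_minus (fun t => phi' t ^ 2) (fun t => phi t ^ 2));
      apply ex_RInt_continuity; intros x; solve_continuous. }
  assert (0 <= t ^ 2 * RInt w 0 (2 * PI)) by (apply Rmult_le_pos; [apply pow2_ge_0|lra]).
  split; [lra|].
  intros Eq.
  (* Equality makes the energy of [psi] equal to minus this product, yet that energy is nonnegative.
     As the integral of [w] is positive, [t = 0] and [psi] is [phi] itself. *)
  assert (t2 : t ^ 2 * RInt w 0 (2 * PI) = 0) by lra.
  assert (t0 : t = 0).
  { apply Rmult_integral in t2; destruct t2 as [t2|]; [|lra].
    apply Rsqr_0_uniq; rewrite Rsqr_pow2; exact t2. }
  destruct Q as [a [b Hab]]; [lra|].
  exists a, b; intros x; rewrite <- Hab; unfold psi; rewrite t0; ring.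
Qed.
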